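(* There exists a compound Poisson process $Z(t)$ with positive jumps such that, for $X(t)=\sigma B(t)+Z(t)$ with $\sigma>0$ and $B$ a standard Brownian motion independent of $Z$, $$\limsup_{u\to\infty}\frac{P(\sup_{0\le t\le1}X(t)>u)}{P(X(1)>u)}>1\quad\text{and}\quad\liminf_{u\to\infty}\frac{P(\sup_{0\le t\le1}X(t)>u)}{P(X(1)>u)}=1 .$$
   Context: A compound Poisson process is $Z(t)=\sum_{k=1}^{N(t)}X_k$, where $N$ is a Poisson process independent of the iid jumps $X_k$. *)

(* Defs.v *)
From HB Require Import structures.
From mathcomp Require Import all_boot all_order all_algebra.
From mathcomp Require Import all_classical all_reals all_analysis.
Set Implicit Arguments. Unset Strict Implicit. Unset Printing Implicit Defensive.
Import Order.TTheory GRing.Theory Num.Theory.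
Import numFieldNormedType.Exports.
Local Open Scope classical_set_scope.
Local Open Scope ring_scope.

Definition sigma_rv {d d'} {Ω : measurableType d} {T : measurableType d'}
  (Y : Ω -> T) : set (set Ω) :=
  [set Y @^-1` A | A in [set A : set T | measurable A]].

Definition sigma_proc {d d'} {Ω : measurableType d} {T : measurableType d'}
  {S : Type} (D : set S) (Y : S -> Ω -> T) : set (set Ω) :=
  <<s \bigcup_(s in D) sigma_rv (Y s) >>.

Definition mutually_independent {d} {Ω : measurableType d} {R : realType}
  (P : probability Ω R) {I : eqType} (G : I -> set (set Ω)) : Prop :=
  forall (J : seq I) (A : I -> set Ω), uniq J ->
    (forall i, i \in J -> G i (A i)) ->
    P (\big[setI/setT]_(i <- J) A i) = (\prod_(i <- J) P (A i))%E.

Definition standard_BM {d} {Ω : measurableType d} {R : realType}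
  (P : probability Ω R) (B : R -> Ω -> R) : Prop :=
  [/\ (forall t, 0 <= t -> measurable_fun setT (B t)),
      (forall w, B 0 w = 0),
      (forall w, {within `[0, +oo[, continuous (fun t => B t w)}),
      (forall (n : nat) (t : nat -> R), 0 <= t 0%N ->
          (forall k, (k < n)%N -> t k < t k.+1) ->
          mutually_independent P
            (fun k : 'I_n => sigma_rv (fun w => B (t k.+1) w - B (t k) w))) &
      (forall s t, 0 <= s -> s < t -> forall A : set R, measurable A ->
          P [set w | B t w - B s w \in A] = normal_prob 0 (Num.sqrt (t - s)) A)].

Definition poisson_process {d} {Ω : measurableType d} {R : realType}
  (P : probability Ω R) (lam : R) (N : R -> Ω -> nat) : Prop :=
  (forall t, 0 <= t -> measurable_fun setT (N t)) /\
  [/\ (forall w, N 0 w = 0%N),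
      (forall w s t, 0 <= s -> s <= t -> (N s w <= N t w)%N),
      (forall w t, 0 <= t ->
          (fun s => (N s w)%:R : R) @ at_right t --> ((N t w)%:R : R)),
      (forall (n : nat) (t : nat -> R), 0 <= t 0%N ->
          (forall k, (k < n)%N -> t k < t k.+1) ->
          mutually_independent P
            (fun k : 'I_n => sigma_rv (fun w => (N (t k.+1) w - N (t k) w)%N))) &
      (forall s t, 0 <= s -> s < t -> forall k : nat,
          P [set w | (N t w - N s w)%N = k] =
            (poisson_pmf (lam * (t - s)) k)%:E)].

(* indices of the independent building blocks: B, N and the jumps X_k *)
Inductive cpp_idx := idxB | idxN | idxX of nat.
Definition cpp_idx_eqb (i j : cpp_idx) : bool :=
  match i, j with
  | idxB, idxB => true | idxN, idxN => true
  | idxX m, idxX n => (m == n)%N | _, _ => false end.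
Lemma cpp_idx_eqP : Equality.axiom cpp_idx_eqb.
Proof.
case=> [||m] [||n] /=; try by constructor.
by apply: (iffP eqP) => [->|[]].
Qed.
HB.instance Definition _ := hasDecEq.Build cpp_idx cpp_idx_eqP.

(* the compound Poisson process Z(t) = sum_{k=1}^{N(t)} X_k
   (jumps indexed from 0 here) *)
Definition compound_poisson {d} {Ω : measurableType d} {R : realType}
  (N : R -> Ω -> nat) (X : nat -> Ω -> R) : R -> Ω -> R :=
  fun t w => \sum_(k < N t w) X k w.

Definition sup_ratio {d} {Ω : measurableType d} {R : realType}
  (P : probability Ω R) (Y : R -> Ω -> R) (u : R) : R :=
  fine (P [set w | u < sup [set Y t w | t in `[0, 1]]]) /
  fine (P [set w | u < Y 1 w]).

Definition limsup_pinfty {R : realType} (f : R -> R) : \bar R :=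
  limf_esup (fun u => (f u)%:E) (pinfty_nbhs R).
Definition liminf_pinfty {R : realType} (f : R -> R) : \bar R :=
  limf_einf (fun u => (f u)%:E) (pinfty_nbhs R).

(* Main.v *)
(** The jump law puts mass [2^-(n+1)] on the very sparse atoms [a_n = 2^(n^2)], at
    rate 1.  Reaching level [a_n / 2] without a jump of size at least [a_n] requires
    either a huge Brownian supremum or about [a_n / a_(n-1)] jumps, and both have
    probability [O(4^-n)], negligible against [P(X(1) > a_n / 2)], which is of order
    [2^-n].

    - At [u = a_n / 2], after a jump of size at least [a_n] the endpoint exceeds [u]
      unless [sigma B(1) <= - a_n / 4]; hence [P(sup X > u, X(1) <= u) = O(4^-n)]
      and the ratio tends to 1.
    - At [u = a_n], a single jump equal to [a_n] before time 1/2, followed by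
      [B(1/2) > 0] and [B(1) <= 0], gives [sup X > u >= X(1)]; this event has
      probability of order [2^-n], as does [X(1) > u], so the ratio stays away
      from 1. *)

Require Import Defs.
From HB Require Import structures.
From mathcomp Require Import all_boot all_order all_algebra.
From mathcomp Require Import all_classical all_reals all_analysis.
From mathcomp Require Import measurable_realfun ring lra zify.
Import Order.TTheory GRing.Theory Num.Theory.
Import numFieldNormedType.Exports.
Local Open Scope classical_set_scope.
Local Open Scope ring_scope.
Set Implicit Arguments.
Unset Strict Implicit.
Unset Printing Implicit Defensive.

(** * Union bounds summed by geometric series *)

Lemma nneseries_geometric_le (R : realType) (f : nat -> \bar R) (c r : R) :
  0 <= c -> 0 < r < 1 -> (forall k, 0 <= f k)%E ->
  (forall k, f k <= (c * r ^+ k)%:E)%E ->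
  (\sum_(0 <= k <oo) f k <= (c / (1 - r))%:E)%E.
Proof.
move=> c0 /andP[r0 r1] f0 fle.
apply: (lime_le (is_cvg_nneseries (fun n _ _ => f0 n))); apply: nearW => n.
apply: (@le_trans _ _ (\sum_(0 <= k < n) (c * r ^+ k)%:E)%E).
  by apply: lee_sum => k _; exact: fle.
rewrite sumEFin lee_fin.
by apply: (@geometric_le_lim R n c r) => //; rewrite ger0_norm // ltW.
Qed.

Section measure_bounds.
Context d (T : measurableType d) (R : realType) (mu : {measure set T -> \bar R}).

Lemma measure_bigcup_geometric_le (A : set T) (E : nat -> set T) (c r : R) :
  0 <= c -> 0 < r < 1 -> measurable A -> (forall k, measurable (E k)) ->
  A `<=` \bigcup_k E k -> (forall k, mu (E k) <= (c * r ^+ k)%:E)%E ->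
  (mu A <= (c / (1 - r))%:E)%E.
Proof.
move=> c0 r01 mA mE AE Ele.
have /le_trans := measure_sigma_subadditive mu mE mA AE; apply.
exact: nneseries_geometric_le.
Qed.

Lemma measure_bigcup_ord_le (E : nat -> set T) (n : nat) (c : R) :
  (forall k, measurable (E k)) ->
  (forall k, (k < n)%N -> (mu (E k) <= c%:E)%E) ->
  (mu (\big[setU/set0]_(i < n) E i) <= (n%:R * c)%:E)%E.
Proof.
move=> mE Ele; apply: (le_trans (Boole_inequality mu _)) => //.
apply: (@le_trans _ _ (\sum_(i < n) c%:E)%E).
  by apply: lee_sum => i _; exact: Ele.
by rewrite sumEFin lee_fin sumr_const card_ord mulr_natl.
Qed.

Lemma measureU_le (A B : set T) (a b : R) : measurable A -> measurable B ->
  (mu A <= a%:E)%E -> (mu B <= b%:E)%E -> (mu (A `|` B) <= (a + b)%:E)%E.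
Proof.
move=> mA mB Aa Bb; apply: le_trans (measureU2 _ _ _) _ => //.
by rewrite EFinD leeD.
Qed.

End measure_bounds.

(** * Gaussian lower and upper bounds *)

(** The quadratic term of the exponential series bounds [expR z] from below. A Gaussian tail at
    level [x] then decays like [x^-4], which is enough for the estimates below. *)
Lemma expRN_le_sqr (R : realType) (z : R) : 0 < z -> expR (- z) <= 2 / z ^+ 2.
Proof.
move=> z0; rewrite expRN -[2 / _]invrK invf_div lef_pV2 ?posrE ?expR_gt0 //.
  by have := expR_ge1Dxn 1 (ltW z0); rewrite (_ : 2`! = 2)%N //; lra.
by rewrite divr_gt0 // exprn_gt0.
Qed.

Section normal_bounds.
Context (R : realType).
Local Notation mu := (@lebesgue_measure R).

(** On [[a, b]] the density is at least [c], its value at [M], because [|x| <= M] there. *)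
Lemma normal_prob_itv_gt0 (s a b : R) : 0 < s -> a < b ->
  (0 < normal_prob 0 s `[a, b])%E.
Proof.
move=> s0 ab.
pose M : R := `|a| + `|b|.
pose c : R := normal_peak s * expR (- M ^+ 2 / (s ^+ 2 *+ 2)).
have c0 : 0 < c by rewrite mulr_gt0 ?expR_gt0 // normal_peak_gt0 // gt_eqF.
have mpdf : measurable_fun `[a, b] (EFin \o normal_pdf 0 s).
  apply/measurable_EFinP; apply: measurable_funTS; exact: measurable_normal_pdf.
apply: (@lt_le_trans _ _ (\int[mu]_(x in `[a, b]) c%:E)%E).
  rewrite integral_cst //= lebesgue_measure_itv /= lte_fin ab.
  by rewrite -EFinD -EFinM lte_fin mulr_gt0 // subr_gt0.
apply: ge0_le_integral => //.
- by move=> x _; rewrite lee_fin ltW.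
move=> x /=; rewrite in_itv /= => /andP[ax xb].
rewrite lee_fin normal_pdfE ?gt_eqF // ler_pM2l ?normal_peak_gt0 ?gt_eqF //.
rewrite /normal_fun ler_expR subr0 !mulNr lerN2 ler_pM2r; last first.
  by rewrite invr_gt0 pmulrn_lgt0 // exprn_gt0.
rewrite -[x ^+ 2]real_normK ?num_real // ler_sqr ?nnegrE ?addr_ge0 //.
rewrite ler_norml; apply/andP; split.
  have := ler_norm (- a); rewrite normrN; have := normr_ge0 b; rewrite /M; lra.
have := ler_norm b; have := normr_ge0 a; rewrite /M; lra.
Qed.

Lemma measurable_gt_norm (y : R) : measurable [set x : R | y < `|x|].
Proof.
rewrite (_ : mkset _ = (fun x : R => `|x|) @^-1` `]y, +oo[).
  by rewrite -[X in measurable X]setTI; apply: measurableT_comp.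
by apply/seteqP; split => x /=; rewrite in_itv /= andbT.
Qed.

(* On [`|x| > y] the exponent [x^2/2s^2] is at least [x^2/4s^2 + y^2/4s^2], so
   the density is dominated by a multiple of that of the normal law with
   variance [2s^2]. *)
Lemma normal_prob_tail_le (s y : R) : 0 < s -> 0 <= y ->
  (normal_prob 0 s [set x | (y < `|x|)%R] <=
   (2 * expR (- (y ^+ 2 / (4 * s ^+ 2))))%:E)%E.
Proof.
move=> s0 y0; set A := [set x : R | _].
have mA : measurable A by exact: measurable_gt_norm.
pose t := s * Num.sqrt 2.
have s2 : 0 < (Num.sqrt 2 : R) by rewrite sqrtr_gt0.
have t0 : 0 < t by rewrite mulr_gt0.
have t2 : t ^+ 2 = 2 * s ^+ 2 by rewrite exprMn sqr_sqrtr // mulrC.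
set c := (2 * _).
have c0 : 0 <= c by rewrite mulr_ge0 ?expR_ge0.
have mpdf u : measurable_fun A (EFin \o normal_pdf 0 u).
  by apply/measurable_EFinP; apply: measurable_funTS; exact: measurable_normal_pdf.
apply: (@le_trans _ _ (\int[mu]_(x in A) (c%:E * (normal_pdf 0 t x)%:E))%E).
  apply: ge0_le_integral => //.
  - by move=> x _; rewrite lee_fin normal_pdf_ge0.
  - exact: mpdf.
  - by apply: emeasurable_funM => //; exact: mpdf.
  move=> x Ax; rewrite -EFinM lee_fin !normal_pdfE ?gt_eqF //.
  have -> : normal_peak t = normal_peak s / Num.sqrt 2.
    rewrite /normal_peak t2 -invfM -sqrtrM; last first.
      by rewrite pmulrn_lge0 // mulr_ge0 ?sqr_ge0 ?pi_ge0.
    by congr (Num.sqrt _)^-1; ring.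
  rewrite (_ : c * _ = normal_peak s * ((Num.sqrt 2)^-1 * (c * normal_fun 0 t x)));
    last ring.
  rewrite ler_pM2l ?normal_peak_gt0 ?gt_eqF //.
  rewrite /c /normal_fun -(mulrA 2) -expRD !subr0 t2.
  apply: (@le_trans _ _ (expR (- (y ^+ 2 / (4 * s ^+ 2)) + - x ^+ 2 / (2 * s ^+ 2 *+ 2)))).
    rewrite ler_expR -subr_ge0.
    rewrite (_ : _ - _ = (x ^+ 2 - y ^+ 2) / (4 * s ^+ 2)); last first.
      by field; rewrite gt_eqF.
    rewrite divr_ge0 //; last by rewrite mulr_ge0 // sqr_ge0.
    rewrite subr_ge0 -[x ^+ 2]real_normK ?num_real // ler_sqr ?nnegrE //.
    exact: ltW.
  (* The factor 2 in [c] absorbs the ratio [sqrt 2] of the two peaks. *)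
  rewrite [leRHS]mulrA ler_peMl ?expR_ge0 // mulrC ler_pdivlMr // mul1r.
  rewrite -[leRHS]ger0_norm // -sqrtr_sqr ler_wsqrtr //; lra.
rewrite ge0_integralZl //; last by move=> x _; rewrite lee_fin normal_pdf_ge0.
  2: exact: mpdf.
rewrite -[leRHS]mule1; apply: lee_wpmul2l; first by rewrite lee_fin.
by have := @probability_le1 _ _ _ (normal_prob 0 t) A mA; apply.
Qed.

End normal_bounds.

(** * Dyadic points of the unit interval *)

Definition dyadic {R : realType} (j i : nat) : R := i%:R / 2 ^+ j.

Section dyadic.
Context {R : realType}.
Implicit Types (f : R -> R) (t u x : R) (i j : nat).

Lemma dyadic_ge0 i j : 0 <= dyadic j i :> R.
Proof. by rewrite divr_ge0 // exprn_ge0. Qed.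

Lemma dyadic_le1 i j : (i <= 2 ^ j)%N -> dyadic j i <= 1 :> R.
Proof.
by move=> ij; rewrite ler_pdivrMr ?exprn_gt0 // mul1r -natrX ler_nat.
Qed.

Lemma dyadicS_gt j i : dyadic j i < dyadic j i.+1 :> R.
Proof. by rewrite ltr_pM2r ?invr_gt0 ?exprn_gt0 // ltr_nat. Qed.

Lemma dyadicSB j i : dyadic j i.+1 - dyadic j i = (2 ^+ j)^-1 :> R.
Proof. by rewrite -mulrBl -natrB // subSnn mul1r. Qed.

Lemma dyadic_double j i : dyadic j.+1 i.*2 = dyadic j i :> R.
Proof.
rewrite /dyadic exprS -muln2 natrM invfM mulrA mulfK //.
Qed.

Lemma dyadic_dense t (e : R) : 0 <= t < 1 -> 0 < e ->
  exists j i, [/\ (i <= 2 ^ j)%N, t < dyadic j i & dyadic j i < t + e].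
Proof.
move=> /andP[t0 t1] e0.
(* A mesh below [1 - t] keeps the next dyadic point inside the unit interval. *)
have d0 : 0 < Num.min e (1 - t) by rewrite lt_min e0 subr_gt0.
have [j jd] : exists j, ((2 : R) ^+ j)^-1 < Num.min e (1 - t).
  have [j _ hj] : \forall j \near \oo, geometric 1 (2^-1 : R) j < Num.min e (1 - t).
    have h1 : `|(2^-1 : R)| < 1 by rewrite ger0_norm; lra.
    exact: (cvgr_lt _ (cvg_geometric 1 h1)).
  by exists j; have := hj j (leqnn j); rewrite /geometric /= mul1r exprVn.
have p0 : 0 < (2 : R) ^+ j by rewrite exprn_gt0.
have /andP[lo hi] := truncn_itv (mulr_ge0 t0 (ltW p0)).
move: jd; rewrite lt_min => /andP[je jt].
have ti : t < dyadic j (Num.truncn (t * 2 ^+ j)).+1 by rewrite ltr_pdivlMr.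
have it : dyadic j (Num.truncn (t * 2 ^+ j)).+1 <= t + (2 ^+ j)^-1.
  rewrite -(dyadicSB j (Num.truncn (t * 2 ^+ j))) addrC -addrA lerDl.
  by rewrite addrC subr_ge0 ler_pdivrMr.
exists j, (Num.truncn (t * 2 ^+ j)).+1; split => //.
  have : dyadic j (Num.truncn (t * 2 ^+ j)).+1 <= 1 :> R by apply: le_trans it _; lra.
  by rewrite /dyadic ler_pdivrMr // mul1r -natrX ler_nat.
by apply: le_lt_trans it _; lra.
Qed.

(** At [t < 1] right-continuity carries a strict exceedance to a dyadic point just after [t], while
    [t = 1] is itself dyadic. Exceedance by the supremum thus becomes a countable union over dyadic
    times. *)
Lemma lt_sup_dyadic f u : has_ubound [set f t | t in `[0, 1]] ->
  (forall t, 0 <= t < 1 -> f x @[x --> t^'+] --> f t) ->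
  u < sup [set f t | t in `[0, 1]] <->
  exists j i, (i <= 2 ^ j)%N /\ u < f (dyadic j i).
Proof.
move=> ub cf; split=> [|[j [i [ij uf]]]]; last first.
  apply: lt_le_trans uf _; apply: ub_le_sup => //; exists (dyadic j i) => //=.
  by rewrite in_itv /= dyadic_ge0 dyadic_le1.
move=> /sup_gt[]; first by exists (f 0), 0 => //=; rewrite in_itv /= lexx ler01.
move=> _ [t + <-] uft; rewrite /= in_itv /= => /andP[t0].
rewrite le_eqVlt => /orP[/eqP t1|t1].
  by exists 0%N, 1%N; rewrite /dyadic expr0 divr1 -t1.
have t01 : 0 <= t < 1 by rewrite t0.
have := cvgr_gt _ (cf t t01) _ uft => -[e /= e0 he].
have [j [i [ij ti it]]] := dyadic_dense t01 e0.
exists j, i; split => //; apply: he => //=.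
by rewrite ltr0_norm ?subr_lt0 // opprB ltrBlDl.
Qed.

(** Induction on the level: an even index at level [j.+1] is a point of level [j], and an odd index
    lies one increment of size at most [y j.+1] to the right of an even one. *)
Lemma dyadic_chaining f (y : nat -> R) : f 0 = 0 -> 0 <= y 0%N ->
  (forall j i, (i < 2 ^ j)%N -> `|f (dyadic j i.+1) - f (dyadic j i)| <= y j) ->
  forall j i, (i <= 2 ^ j)%N -> `|f (dyadic j i)| <= \sum_(l < j.+1) y l.
Proof.
move=> f0 y0 yle; elim=> [|j IH] i ij.
  rewrite big_ord_recl big_ord0 addr0; case: i ij => [|[|//]] _.
    by rewrite /dyadic mul0r f0 normr0.
  have := yle 0%N 0%N isT.
  by rewrite [dyadic _ 0]mul0r f0 subr0.
have ynneg : 0 <= y j.+1 by apply: le_trans (yle j.+1 0%N _) => //; rewrite expn_gt0.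
have even k : (k <= 2 ^ j)%N -> `|f (dyadic j.+1 k.*2)| <= \sum_(l < j.+1) y l.
  by move=> kj; rewrite dyadic_double IH.
rewrite big_ord_recr /= -(odd_double_half i).
case: (boolP (odd i)) => oi; last first.
  rewrite add0n (le_trans (even _ _)) ?lerDl //.
  by move: ij; rewrite expnS mul2n -{1}(odd_double_half i) (negbTE oi) add0n leq_double.
rewrite add1n.
have ij' : (i./2.*2 < 2 ^ j.+1)%N.
  by move: ij; rewrite -{1}(odd_double_half i) oi.
have kj : (i./2 <= 2 ^ j)%N.
  by move: ij'; rewrite expnS mul2n ltn_double => /ltnW.
have := yle _ _ ij'; have := even _ kj.
have := ler_normD (f (dyadic j.+1 i./2.*2.+1) - f (dyadic j.+1 i./2.*2))
                  (f (dyadic j.+1 i./2.*2)).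
rewrite subrK; lra.
Qed.

End dyadic.

(** * Brownian motion: increments and a maximal inequality *)

Section brownian_motion.
Context d (Ω : measurableType d) (R : realType) (P : probability Ω R).
Variable B : R -> Ω -> R.
Hypothesis bm : standard_BM P B.

Lemma measurable_BM t : 0 <= t -> measurable_fun setT (B t).
Proof. by case: bm => + _ _ _ _; exact. Qed.

Lemma BM0 w : B 0 w = 0.
Proof. by case: bm. Qed.

Lemma BM_right_continuous w t : 0 <= t -> B s w @[s --> t^'+] --> B t w.
Proof.
case: bm => _ _ /(_ w)/continuous_within_itvcyP[cB cB0] _ _.
rewrite le_eqVlt => /orP[/eqP <-//|t0].
by apply: cvg_at_right_filter; apply: cB; rewrite in_itv /= t0.
Qed.

Lemma BM_bounded01 w : exists M, forall t, 0 <= t <= 1 -> B t w <= M.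
Proof.
case: bm => _ _ /(_ w) cB _ _.
have cB1 : {within `[0, 1], continuous (B ^~ w)}.
  by apply: continuous_subspaceW cB => t /=; rewrite !in_itv /= => /andP[->].
have [c _ hc] := EVT_max (@ler01 R) cB1.
by exists (B c w) => t t01; apply: hc; rewrite in_itv.
Qed.

Lemma measurable_BM_increment s t (A : set R) : 0 <= s -> 0 <= t ->
  measurable A -> measurable [set w | A (B t w - B s w)].
Proof.
move=> s0 t0 mA.
have mf : measurable_fun setT (fun w => B t w - B s w).
  by apply: measurable_funB; exact: measurable_BM.
by have := mf measurableT A mA; rewrite setTI.
Qed.

Lemma BM_increment s t (A : set R) : 0 <= s -> s < t -> measurable A ->
  P [set w | A (B t w - B s w)] = normal_prob 0 (Num.sqrt (t - s)) A.
Proof.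
move=> s0 st mA; case: bm => _ _ _ _ /(_ s t s0 st A mA) <-.
by congr (P _); apply/seteqP; split => w /=; rewrite in_setE.
Qed.

Lemma BM_increment_tail s t y : 0 <= s -> s < t -> 0 <= y ->
  (P [set w | (y < `|B t w - B s w|)%R] <=
   (2 * expR (- (y ^+ 2 / (4 * (t - s)))))%:E)%E.
Proof.
move=> s0 st y0.
have := BM_increment s0 st (measurable_gt_norm y) => /= ->.
apply: le_trans (normal_prob_tail_le _ y0) _; first by rewrite sqrtr_gt0 subr_gt0.
by rewrite sqr_sqrtr // subr_ge0 ltW.
Qed.

(* The increments of level [j] are allowed the share [x/10 (9/10)^j] of [x];
   their variance is [2^-j], and [2 (9/10)^4 > 1] makes the union bound over all
   levels a convergent geometric series. *)
Lemma BM_dyadic_maximal (x : R) : 0 < x ->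
  exists E : set Ω, [/\ measurable E, (P E <= (320 / (x / 10) ^+ 4)%:E)%E &
    forall w, ~ E w -> forall j i, (i <= 2 ^ j)%N -> `|B (dyadic j i) w| <= x].
Proof.
move=> x0; set v := x / 10; have v0 : 0 < v by rewrite divr_gt0.
pose y j : R := v * (9 / 10) ^+ j.
have y0 j : 0 < y j by rewrite mulr_gt0 ?exprn_gt0 ?divr_gt0.
pose D j i := [set w | y j < `|B (dyadic j i.+1) w - B (dyadic j i) w|].
have mD j i : measurable (D j i).
  by apply: (measurable_BM_increment _ _ (measurable_gt_norm (y j)));
    exact: dyadic_ge0.
pose E j := \big[setU/set0]_(i < 2 ^ j) D j i.
have mE j : measurable (E j) by apply: bigsetU_measurable.
exists (\bigcup_j E j); split.
- exact: bigcup_measurable.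
(* Level [j] contributes at most [64 / v ^+ 4 * (4 / 5) ^+ j]: each of its [2 ^ j] increments has
   tail at most [2 * (2 / z ^+ 2)], and [2 * (9 / 10) ^+ 4 >= 5 / 4]. *)
- rewrite (_ : 320 / v ^+ 4 = 64 / v ^+ 4 / (1 - 4 / 5)); last first.
    by rewrite [RHS]mulrAC; congr (_ / _); field.
  apply: (@measure_bigcup_geometric_le _ _ _ P _ E) => //.
  + by rewrite divr_ge0 // exprn_ge0 // ltW.
  + by apply/andP; split; lra.
  + exact: bigcup_measurable.
  move=> j; have p0 : 0 < (2 : R) ^+ j by rewrite exprn_gt0.
  set q : R := (9 / 10) ^+ j; have q0 : 0 < q by rewrite exprn_gt0 // divr_gt0.
  set z : R := (y j) ^+ 2 / (4 * (2 ^+ j)^-1).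
  have z0 : 0 < z by rewrite divr_gt0 ?exprn_gt0 // mulr_gt0 ?invr_gt0.
  apply: (@le_trans _ _ ((2 ^ j)%:R * (2 * (2 / z ^+ 2)))%:E).
    apply: measure_bigcup_ord_le => // i ij.
    apply: (le_trans (BM_increment_tail _ _ _)).
    + exact: dyadic_ge0.
    + exact: dyadicS_gt.
    + exact/ltW/y0.
    by rewrite dyadicSB lee_fin ler_pM2l //; exact: expRN_le_sqr.
  rewrite lee_fin natrX.
  have -> : 2 ^+ j * (2 * (2 / z ^+ 2)) = 64 / v ^+ 4 * (q ^+ 4 * 2 ^+ j)^-1.
    move: (2 ^+ j) p0 @z z0 => p p0 z _; rewrite /z /y -/q; field.
    by rewrite !gt_eqF.
  rewrite ler_pM2l ?divr_gt0 ?exprn_gt0 // -[leLHS]div1r ler_pdivrMr; last first.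
    by rewrite mulr_gt0 // exprn_gt0.
  by rewrite /q -exprM mulnC exprM -!exprMn exprn_ege1 //; lra.
move=> w nE j i ij.
apply: (le_trans (@dyadic_chaining R (B ^~ w) y (BM0 w) _ _ j i ij)).
- exact/ltW/y0.
- move=> l k kl; rewrite leNgt; apply/negP => yB; apply: nE; exists l => //.
  by rewrite /E -bigcup_mkord; exists k.
rewrite -(big_mkord xpredT y).
(* The shares [y l] sum to at most [v / (1 - 9 / 10) = x]. *)
apply: (le_trans (@geometric_le_lim R j.+1 v (9 / 10) _ _ _)).
- exact: ltW.
- lra.
- by rewrite ger0_norm; lra.
- by rewrite (_ : v / _ = x) // /v; field.
Qed.

End brownian_motion.

(** * The Poisson process *)

Section poisson.
Context d (Ω : measurableType d) (R : realType) (P : probability Ω R).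
Variable N : R -> Ω -> nat.
Hypothesis pp : poisson_process P 1 N.

Lemma measurable_PP t (A : set nat) : 0 <= t -> measurable (N t @^-1` A).
Proof.
by move=> t0; have := pp.1 t t0 measurableT A; rewrite setTI; apply.
Qed.

Lemma PP_mono w s t : 0 <= s -> s <= t -> (N s w <= N t w)%N.
Proof. by case: pp => _ [_ + _ _ _]; exact. Qed.

(** Just after [t] the monotone path is at least [N t w] and, by right-continuity, below
    [N t w + 1]; integer values leave only [N t w]. *)
Lemma PP_right_constant w t : 0 <= t -> \forall s \near t^'+, N s w = N t w.
Proof.
case: pp => _ [_ mono /(_ w t) cN _ _] t0.
have h := cvgr_lt _ (cN t0) ((N t w)%:R + 1) _.
near=> s; apply/eqP; rewrite eqn_leq; apply/andP; split.
  rewrite -ltnS -(ltr_nat R) -natr1.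
  by near: s; apply: h; rewrite ltrDl.
by apply: mono => //; near: s; exact: nbhs_right_ge.
Unshelve. all: by end_near. Qed.

Lemma PP1_pmf k : P [set w | N 1 w = k] = ((k`!%:R)^-1 * expR (-1))%:E.
Proof.
case: pp => _ [N0 _ _ _ /(_ 0 1 (lexx _) ltr01 k)].
rewrite (_ : mkset _ = [set w | N 1 w = k]); last first.
  by apply/seteqP; split => w /=; rewrite N0 subn0.
by move=> ->; rewrite mul1r subr0 /poisson_pmf ltr01 expr1n mul1r.
Qed.

(** The masses are dominated by a geometric sequence, since [expR (-1) <= 1] and the factorial of
    [n.+1] is at least [2 ^ n]. *)
Lemma PP1_tail k : (P [set w | (k < N 1 w)%N] <= (2 * (1 / 2) ^+ k)%:E)%E.
Proof.
rewrite (_ : 2 * _ = (1 / 2) ^+ k / (1 - 1 / 2)); last by field.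
apply: (@measure_bigcup_geometric_le _ _ _ P _ (fun m => [set w | N 1 w = (k + m).+1])).
- by rewrite exprn_ge0 //; lra.
- by apply/andP; split; lra.
- exact: (@measurable_PP 1 [set m | (k < m)%N] ler01).
- by move=> m; exact: (@measurable_PP 1 [set (k + m).+1] ler01).
- by move=> w /= kN; exists (N 1 w - k.+1)%N => //=; lia.
move=> m; apply: (@le_trans _ _ (((k + m).+1`!%:R)^-1 * expR (-1))%:E).
  by rewrite -PP1_pmf.
rewrite lee_fin -exprD.
have e1 : expR (-1) <= 1 :> R by rewrite -[leRHS]expR0 ler_expR; lra.
apply: (@le_trans _ _ ((k + m).+1`!%:R)^-1); first by rewrite ler_piMr ?invr_ge0.
rewrite div1r exprVn lef_pV2 ?posrE ?exprn_gt0 ?ltr0n ?fact_gt0 //.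
rewrite -natrX ler_nat; elim: (k + m)%N => [//|n IH].
rewrite expnS factS; apply: leq_mul => //.
Qed.

End poisson.

(** * The jump law on sparse atoms *)

Section jump_law.
Context {R : realType}.

(* The quadratic exponent makes [atom n.+1 / atom n] exceed [4^n]. *)
Definition atom (n : nat) : R := 2 ^+ (n * n).

Definition atom_weight (n : nat) : {nonneg R} := ((2^-1 : R) ^+ n.+1)%:nng.

Definition jump_law : set R -> \bar R :=
  mseries (fun n => mscale (atom_weight n) (dirac (atom n))) 0.

HB.instance Definition _ := Measure.on jump_law.

Lemma jump_lawE (A : set R) :
  jump_law A = (\sum_(0 <= k <oo) ((2^-1) ^+ k.+1)%:E * \d_(atom k) A)%E.
Proof. by []. Qed.

Let jump_law_setT : jump_law setT = 1%E.
Proof.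
rewrite jump_lawE; apply/cvg_lim => //.
rewrite (_ : (fun n => _) = EFin \o series (geometric (2^-1) (2^-1 : R))).
  apply: cvg_EFin; first by apply: nearW.
  rewrite (_ : fine \o _ = series (geometric (2^-1) (2^-1 : R))) //.
  rewrite [X in _ --> X](_ : _ = 2^-1 * (1 - 2^-1)^-1); last by field.
  by apply: cvg_geometric_series; rewrite ger0_norm; lra.
apply/funext => n /=; rewrite /series /= -sumEFin; apply: eq_bigr => k _.
by rewrite diracT mule1 exprS.
Qed.

HB.instance Definition _ := Measure_isProbability.Build _ _ _ jump_law jump_law_setT.

Lemma atom_gt0 n : 0 < atom n.
Proof. by rewrite exprn_gt0. Qed.

Lemma atom_le m n : (m <= n)%N -> atom m <= atom n.
Proof. by move=> mn; rewrite ler_eXn2l ?ltr1n // leq_mul. Qed.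

Lemma atom_lt m n : atom m < atom n -> (m < n)%N.
Proof. by move=> mn; rewrite ltnNge; apply/negP => /atom_le; rewrite leNgt mn. Qed.

Lemma expn_le_atom n : 2 ^+ n <= atom n.
Proof. by rewrite ler_eXn2l ?ltr1n //; case: n => // n; rewrite leq_pmulr. Qed.

Lemma measurable_range_atom : measurable (range atom).
Proof.
rewrite (_ : range atom = \bigcup_n [set atom n]).
  by apply: bigcup_measurable => n _; exact: measurable_set1.
by apply/seteqP; split => [x [n _ <-]|x [n _ ->]]; exists n.
Qed.

Lemma jump_law_rangeC : jump_law (~` range atom) = 0%E.
Proof.
rewrite jump_lawE eseries0 // => k _ _.
by rewrite diracE memNset ?mule0 //=; apply; exists k.
Qed.

(** Only the term of index [n] of the series is kept. *)
Lemma jump_law_atom n : (((2^-1) ^+ n.+1)%:E <= jump_law [set atom n])%E.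
Proof.
rewrite jump_lawE; apply: le_trans (nneseries_lim_ge n.+1 _); last first.
  by move=> k _ _; rewrite mule_ge0 // lee_fin.
rewrite big_nat_recr //= diracE mem_set // mule1 leeDr //.
by apply: sume_ge0 => k _; rewrite mule_ge0 // lee_fin.
Qed.

(** Atoms of index below [n] lie strictly left of the half-line, and the weights [2^-(k+1)] with
    [k >= n] sum to [2^-n]. *)
Lemma jump_law_tail n : (jump_law `[atom n, +oo[ <= ((2^-1) ^+ n)%:E)%E.
Proof.
have nneg k : (0 <= ((2^-1) ^+ k.+1)%:E * \d_(atom k) `[atom n, +oo[ :> \bar R)%E.
  by rewrite mule_ge0 // lee_fin.
rewrite jump_lawE (nneseries_split 0 n) //= add0n big_nat big1; last first.
  move=> k /= kn; rewrite diracE memNset ?mule0 //= in_itv /= andbT => nk.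
  have := atom_le (ltnW kn); rewrite le_eqVlt => /orP[/eqP e|].
    by have : atom k < atom n; [rewrite ltr_eXn2l ?ltr1n // ltn_mul|rewrite e ltxx].
  by rewrite ltNge nk.
rewrite add0e -nneseries_addn //.
rewrite (_ : 2^-1 ^+ n = 2^-1 ^+ n.+1 / (1 - 2^-1)); last by rewrite exprS; field.
apply: nneseries_geometric_le => //.
- by apply/andP; split; lra.
move=> k; rewrite diracE -EFinM lee_fin -exprD addSn [(n + k)%N]addnC.
by case: (_ \in _); rewrite ?mulr1 ?mulr0.
Qed.

End jump_law.

(** * Upper and lower limits at infinity *)

Section limits_at_infinity.
Context {R : realType}.
Implicit Types (f : R -> R) (c : R).

(** Every neighbourhood of infinity contains a ray, hence a point of value at least [c]; the limsup
    can thus be tested along the levels [atom n]. *)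
Lemma limsup_pinfty_ge f c : (forall M, exists2 u, M < u & c <= f u) ->
  (c%:E <= limsup_pinfty f)%E.
Proof.
move=> fc; rewrite /limsup_pinfty limf_esupE.
apply: le_ereal_inf_tmp => _ [V [M [_ MV]] <-].
have [u Mu cfu] := fc M.
apply: (@le_trans _ _ (f u)%:E); first by rewrite lee_fin.
by apply: ereal_sup_ubound; exists u => //; exact: MV.
Qed.

(** Dual test, with a slack [e] because the ratio only approaches its limit along the test
    levels. *)
Lemma liminf_pinfty_le f c :
  (forall M e, 0 < e -> exists2 u, M < u & f u <= c + e) ->
  (liminf_pinfty f <= c%:E)%E.
Proof.
move=> fc; rewrite /liminf_pinfty limf_einfE.
apply: ge_ereal_sup => _ [V [M [_ MV]] <-].
apply/lee_addgt0Pr => e e0; have [u Mu fu] := fc M e e0.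
apply: (@le_trans _ _ (f u)%:E); last by rewrite -EFinD lee_fin.
by apply: ereal_inf_lbound; exists u => //; exact: MV.
Qed.

Lemma liminf_pinfty_ge f c : (forall u, c <= f u) -> (c%:E <= liminf_pinfty f)%E.
Proof.
move=> cf; rewrite /liminf_pinfty limf_einfE.
apply: (@le_trans _ _ (ereal_inf ((fun u => (f u)%:E) @` setT))).
  by apply: le_ereal_inf_tmp => _ [u _ <-]; rewrite lee_fin.
by apply: ereal_sup_ubound; exists setT => //; exact: filterT.
Qed.

End limits_at_infinity.

(** * Sigma-algebras generated by processes *)

Section sigma_proc.
Context d d' (Ω : measurableType d) (T : measurableType d') (S : Type).
Variables (D : set S) (Y : S -> Ω -> T).

Lemma sigma_proc_preimage s (A : set T) : D s -> measurable A ->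
  sigma_proc D Y (Y s @^-1` A).
Proof.
by move=> Ds mA; apply: sub_sigma_algebra; exists s => //; exists A.
Qed.

Lemma sigma_procI (A B : set Ω) :
  sigma_proc D Y A -> sigma_proc D Y B -> sigma_proc D Y (A `&` B).
Proof.
exact: (@measurableI _ (g_sigma_algebraType (\bigcup_(s in D) sigma_rv (Y s)))).
Qed.

Lemma sigma_procT : sigma_proc D Y setT.
Proof.
exact: (@measurableT _ (g_sigma_algebraType (\bigcup_(s in D) sigma_rv (Y s)))).
Qed.

Lemma sigma_proc_measurable : (forall s, D s -> measurable_fun setT (Y s)) ->
  sigma_proc D Y `<=` measurable.
Proof.
move=> mY; apply: smallest_sub; first exact: sigma_algebra_measurable.
move=> _ [s Ds [A mA <-]].
by have := mY s Ds measurableT A mA; rewrite setTI.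
Qed.

End sigma_proc.

(** * Measurability and paths of the perturbed compound Poisson process *)

Section perturbed_compound_poisson.
Context d (Ω : measurableType d) (R : realType) (P : probability Ω R).
Variables (sigma : R) (B : R -> Ω -> R) (N : R -> Ω -> nat) (X : nat -> Ω -> R).
Hypotheses (sigma0 : 0 < sigma) (bm : standard_BM P B).
Hypotheses (pp : poisson_process P 1 N) (mX : forall k, measurable_fun setT (X k)).

Let Y t w := sigma * B t w + compound_poisson N X t w.

(** Splitting by the value [m] of [N t] turns the random number of summands into a fixed one. *)
Lemma measurable_process_gt t u : 0 <= t -> measurable [set w | u < Y t w].
Proof.
move=> t0.
rewrite (_ : mkset _ = \bigcup_m (N t @^-1` [set m] `&`
    [set w | u < sigma * B t w + \sum_(k < m) X k w])); last first.
  apply/seteqP; split => [w uY|w [m _ [/= <-]]//].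
  by exists (N t w).
apply: bigcup_measurable => m _; apply: measurableI.
  exact: measurable_PP pp _ _ t0.
have mf : measurable_fun setT (fun w => sigma * B t w + \sum_(k < m) X k w).
  apply: measurable_funD; last exact: measurable_sum.
  by apply: measurable_funM => //; exact: measurable_BM bm _ t0.
have := mf measurableT _ (measurable_itv `]u, +oo[).
rewrite setTI; congr measurable; apply/seteqP; split => w /=;
  by rewrite in_itv /= andbT.
Qed.

(** Since [N] is nondecreasing, a partial sum at time [t <= 1] involves only jumps counted by [N 1],
    so it is at most the sum of their absolute values. *)
Lemma process_bounded01 w : has_ubound [set Y t w | t in `[0, 1]].
Proof.
have [M BM] := BM_bounded01 bm w.
exists (sigma * M + \sum_(k < N 1 w) `|X k w|) => _ [t + <-].
rewrite /= in_itv /= => t01; apply: lerD; first by rewrite ler_pM2l // BM.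
have /andP[t0 t1] := t01.
rewrite /compound_poisson (big_ord_widen _ (fun k => X k w) (PP_mono pp w t0 t1)).
rewrite big_mkcond; apply: ler_sum => k _ /=.
by case: ifP => _; rewrite ?ler_norm ?normr_ge0.
Qed.

Lemma process_right_continuous w t : 0 <= t -> Y s w @[s --> t^'+] --> Y t w.
Proof.
move=> t0; apply: cvgD.
  by apply: cvgM; [exact: cvg_cst|exact: (BM_right_continuous bm)].
apply: cvg_near_cst; near=> s.
rewrite /compound_poisson; have -> // : N s w = N t w.
by near: s; exact: PP_right_constant pp _ _ t0.
Unshelve. all: by end_near. Qed.

Lemma lt_sup_process w u : u < sup [set Y t w | t in `[0, 1]] <->
  exists j i, (i <= 2 ^ j)%N /\ u < Y (dyadic j i) w.
Proof.
apply: (@lt_sup_dyadic R (Y ^~ w)); first exact: process_bounded01.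
by move=> t /andP[t0 _]; exact: process_right_continuous.
Qed.

Lemma measurable_sup_process_gt u :
  measurable [set w | u < sup [set Y t w | t in `[0, 1]]].
Proof.
rewrite (_ : mkset _ = \bigcup_j \bigcup_(i in [set i | (i <= 2 ^ j)%N])
    [set w | u < Y (dyadic j i) w]); last first.
  apply/seteqP; split=> [w /= /lt_sup_process[j [i [ij uY]]]|w [j _ [i ij uY]]].
    by exists j => //; exists i.
  by apply/lt_sup_process; exists j, i.
apply: bigcup_measurable => j _; apply: bigcup_measurable => i _.
exact/measurable_process_gt/dyadic_ge0.
Qed.

Lemma sup_process_ge1 u w : u < Y 1 w -> u < sup [set Y t w | t in `[0, 1]].
Proof.
by move=> uY; apply/lt_sup_process; exists 0%N, 1%N; rewrite /dyadic expr0 divr1.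
Qed.

End perturbed_compound_poisson.

(** * Lower bounds of order [2^-n] *)

Lemma poisson_pmf_gt0 (R : realType) (r : R) k : 0 < r -> 0 < poisson_pmf r k.
Proof.
move=> r0; rewrite /poisson_pmf r0 mulr_gt0 ?expR_gt0 // mulr_gt0 ?exprn_gt0 //.
Qed.

Lemma mutually_independent2 d (Ω : measurableType d) (R : realType)
    (P : probability Ω R) (G : 'I_2 -> set (set Ω)) (A0 A1 : set Ω) :
  mutually_independent P G -> G ord0 A0 -> G ord_max A1 ->
  P (A0 `&` A1) = (P A0 * P A1)%E.
Proof.
move=> iG G0 G1.
have := iG [:: ord0; ord_max] (fun k => if k == ord0 then A0 else A1) isT.
rewrite !big_cons !big_nil setIT mule1; apply.
by move=> k; rewrite !inE => /orP[] /eqP ->.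
Qed.

Section ratio.
Context d (Ω : measurableType d) (R : realType) (P : probability Ω R).
Variables (sigma : R) (B : R -> Ω -> R) (N : R -> Ω -> nat) (X : nat -> Ω -> R).
Hypotheses (sigma0 : 0 < sigma) (bm : standard_BM P B).
Hypotheses (pp : poisson_process P 1 N) (mX : forall k, measurable_fun setT (X k)).
Hypothesis lawX : forall k (A : set R), measurable A ->
  P (X k @^-1` A) = jump_law A.
Hypothesis indep : mutually_independent P (fun i : cpp_idx =>
  match i with
  | idxB => sigma_proc `[0, +oo[ B
  | idxN => sigma_proc `[0, +oo[ N
  | idxX k => sigma_rv (X k)
  end).

Let Y t w := sigma * B t w + compound_poisson N X t w.
Let S u := [set w | u < sup [set Y t w | t in `[0, 1]]].
Let T u := [set w | u < Y 1 w].

Let mS u : measurable (S u).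
Proof. exact: (measurable_sup_process_gt sigma0 bm pp mX). Qed.

Let mT u : measurable (T u).
Proof. exact: (measurable_process_gt sigma bm pp mX). Qed.

Let TS u : T u `<=` S u.
Proof. by move=> w; exact: (sup_process_ge1 sigma0 bm pp). Qed.

Let nonneg (t : R) : 0 <= t -> `[0, +oo[%classic t.
Proof. by move=> t0; rewrite /= in_itv /= t0. Qed.

Let msigmaB (E : set Ω) : sigma_proc `[0, +oo[ B E -> measurable E.
Proof.
apply: sigma_proc_measurable => t; rewrite /= in_itv /= andbT.
exact: (measurable_BM bm).
Qed.

Let msigmaN (E : set Ω) : sigma_proc `[0, +oo[ N E -> measurable E.
Proof.
apply: sigma_proc_measurable => t; rewrite /= in_itv /= andbT.
by case: pp => + _; exact.
Qed.

Let mXpre k (A : set R) : measurable A -> measurable (X k @^-1` A).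
Proof. by move=> mA; have := mX k measurableT mA; rewrite setTI. Qed.

Let indep_BNX EB EN k (A : set R) : sigma_proc `[0, +oo[ B EB ->
  sigma_proc `[0, +oo[ N EN -> measurable A ->
  P (EB `&` (EN `&` X k @^-1` A)) = (P EB * (P EN * jump_law A))%E.
Proof.
move=> hB hN mA; rewrite -(lawX k mA).
pose E i := match i with idxB => EB | idxN => EN | idxX _ => X k @^-1` A end.
have := @indep [:: idxB; idxN; idxX k] E isT.
rewrite !big_cons !big_nil setIT mule1; apply.
move=> i; rewrite !inE => /or3P[] /eqP -> //=.
by exists A.
Qed.

(** Common source of both lower bounds: the first jump equals [atom n], independently of [B] and
    [N]. The division by 2 comes from the weight [2^-(n+1)]. *)
Let prod_ge (EB EN : set Ω) n : sigma_proc `[0, +oo[ B EB ->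
  sigma_proc `[0, +oo[ N EN ->
  ((fine (P EB) * fine (P EN) / 2 * (2^-1) ^+ n)%:E <=
   P (EB `&` (EN `&` X 0%N @^-1` [set atom n])))%E.
Proof.
move=> hB hN; rewrite (indep_BNX 0 hB hN (measurable_set1 _)).
have fB := fin_num_measure P _ (msigmaB hB).
have fN := fin_num_measure P _ (msigmaN hN).
rewrite -mulrA -exprS -mulrA 2!EFinM !fineK //.
by do 2 (apply: lee_wpmul2l => //); exact: jump_law_atom.
Qed.

(** A single jump by time 1, equal to [atom n], together with [B 1] in [[0, 1]], puts [Y 1] at or
    above [atom n]. *)
Lemma endpoint_lower_bound : exists2 c : R, 0 < c &
  forall n u, u < atom n -> ((c * (2^-1) ^+ n)%:E <= P (T u))%E.
Proof.
pose EB := B 1 @^-1` `[0, 1].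
pose EN := N 1 @^-1` [set 1%N].
have hB : sigma_proc `[0, +oo[ B EB.
  by apply: sigma_proc_preimage => //; exact: nonneg.
have hN : sigma_proc `[0, +oo[ N EN.
  by apply: sigma_proc_preimage => //; exact: nonneg.
exists (fine (P EB) * fine (P EN) / 2).
  rewrite divr_gt0 // mulr_gt0 // fine_gt0 //.
    rewrite (_ : EB = [set w | `[0, 1]%classic (B 1 w - B 0 w)]); last first.
      by apply/seteqP; split => w /=; rewrite (BM0 bm) subr0.
    rewrite (BM_increment bm) // subr0 sqrtr1 normal_prob_itv_gt0 //=.
    by rewrite -ge0_fin_numE // fin_num_measure.
  by have -> := PP1_pmf pp 1; rewrite ltry andbT lte_fin mulr_gt0 ?expR_gt0.
move=> n u un; apply: (le_trans (prod_ge n hB hN)).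
apply: le_measure; rewrite ?inE //.
  apply: measurableI; first exact: msigmaB.
  by apply: measurableI; [exact: msigmaN|exact: mXpre].
move=> w [+ [/= N1 X0]]; rewrite /EB /= in_itv /= => /andP[B0 _].
rewrite /T /= /Y /compound_poisson N1 big_ord_recl big_ord0 X0 addr0.
by apply: (lt_le_trans un); rewrite lerDr mulr_ge0 // ltW.
Qed.

Lemma gap_lower_bound : exists2 c : R, 0 < c &
  forall n, ((c * (2^-1) ^+ n)%:E <= P (S (atom n) `\` T (atom n)))%E.
Proof.
pose h : R := 2^-1.
have h0 : 0 <= h by rewrite /h; lra.
have h0' : 0 < h by rewrite /h; lra.
have h1 : h < 1 by rewrite /h; lra.
pose EB := B h @^-1` `]0, +oo[ `&` B 1 @^-1` `]-oo, 0].
pose EN := N h @^-1` [set 1%N] `&` N 1 @^-1` [set 1%N].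
have hB : sigma_proc `[0, +oo[ B EB.
  by apply: sigma_procI; apply: sigma_proc_preimage => //; exact: nonneg.
have hN : sigma_proc `[0, +oo[ N EN.
  by apply: sigma_procI; apply: sigma_proc_preimage => //; exact: nonneg.
(* The times 0, 1/2, 1 give the two increments whose independence is used for both [N] and [B]. *)
pose t k : R := match k with 0%N => 0 | 1%N => h | _ => 1 end.
have tS k : (k < 2)%N -> t k < t k.+1.
  by case: k => [|[|//]] _; rewrite /= /h; lra.
exists (fine (P EB) * fine (P EN) / 2).
  rewrite divr_gt0 // mulr_gt0 // fine_gt0 //; apply/andP; split; last first.
  - by rewrite -ge0_fin_numE // fin_num_measure //; exact: msigmaN.
  - case: pp => _ [N0 mono _ /(_ 2%N t (lexx 0) tS) iN pmfN].
    have -> : EN = [set w | (N h w - N 0 w)%N = 1%N] `&`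
                   [set w | (N 1 w - N h w)%N = 0%N].
      apply/seteqP; split => w; rewrite /EN /= N0 subn0 => -[Nh].
        by rewrite Nh => ->.
      have := mono w h 1 h0 (ltW h1); rewrite Nh => N1 /eqP; rewrite subn_eq0 => N1'.
      by split => //; apply/eqP; rewrite eqn_leq N1 N1'.
    rewrite (mutually_independent2 iN).
    + rewrite (pmfN 0 h (lexx 0) h0' 1%N) (pmfN h 1 h0 h1 0%N).
      by rewrite -EFinM lte_fin mulr_gt0 // poisson_pmf_gt0 // mul1r; lra.
    + by exists [set 1%N].
    + by exists [set 0%N].
  - by rewrite -ge0_fin_numE // fin_num_measure //; exact: msigmaB.
  - case: bm => _ B0 _ /(_ 2%N t (lexx 0) tS) iB _.
    (* An increment in [[1, 2]] followed by one in [[-3, -2]] forces [B h > 0] and [B 1 <= 0]. *)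
    pose E0 := [set w | `[1, 2]%classic (B h w - B 0 w)].
    pose E1 := [set w | `[-3, -2]%classic (B 1 w - B h w)].
    apply: (@lt_le_trans _ _ (P (E0 `&` E1))).
      rewrite (mutually_independent2 iB).
      + apply: mule_gt0; rewrite (BM_increment bm) //.
        * by apply: normal_prob_itv_gt0; rewrite ?sqrtr_gt0; lra.
        * by apply: normal_prob_itv_gt0; rewrite ?sqrtr_gt0; lra.
      + by exists `[1, 2]%classic; [exact: measurable_itv|].
      + by exists `[-3, -2]%classic; [exact: measurable_itv|].
    apply: le_measure; rewrite ?inE.
    + by apply: measurableI; apply: (measurable_BM_increment bm).
    + exact: msigmaB.
    move=> w []; rewrite /E0 /E1 /EB /= B0 !in_itv /=.
    move=> /andP[? ?] /andP[? ?]; split; lra.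
move=> n; apply: (le_trans (prod_ge n hB hN)).
apply: le_measure; rewrite ?inE //.
- apply: measurableI; first exact: msigmaB.
  by apply: measurableI; [exact: msigmaN|exact: mXpre].
- exact: measurableD.
(* The jump part equals the level exactly at times [h] and 1, so the sign of [B] decides on which
   side the process lies. *)
move=> w [+ [[/= Nh N1] /= X0]]; rewrite /EB /= !in_itv /= andbT => -[Bh B1].
split; last first.
  rewrite /T /= /Y /compound_poisson N1 big_ord_recl big_ord0 X0 addr0.
  by apply/negP; rewrite -leNgt gerDr pmulr_rle0.
have [_] := @lt_sup_process _ _ _ _ _ _ _ X sigma0 bm pp w (atom n); apply.
exists 1%N, 1%N; split => //.
rewrite (_ : dyadic 1 1 = h); last by rewrite /dyadic expr1 mul1r.
rewrite /compound_poisson Nh big_ord_recl big_ord0 X0 addr0.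
by rewrite ltrDr mulr_gt0.
Qed.

(** * Upper bounds outside a rare event *)

(** Turns fourth-power tails at scale [atom n.+1] into [O(4^-n)]; it follows from
    [atom n.+1 >= 2 ^ n >= 1]. *)
Let atom4_ge n : 4 ^+ n <= atom n.+1 ^+ 4 :> R.
Proof.
have h : 2 ^+ n <= atom n.+1 :> R.
  by apply: le_trans (expn_le_atom n.+1); rewrite ler_eXn2l ?ltr1n.
have h1 : 1 <= atom n.+1 :> R by apply: le_trans h; rewrite exprn_ege1 ?ler1n.
rewrite (_ : (4 : R) = 2 ^+ 2); last by ring.
rewrite -exprM mulnC exprM (@le_trans _ _ (atom n.+1 ^+ 2)) //.
  by rewrite ler_sqr ?nnegrE ?exprn_ge0 // (le_trans _ h1).
by rewrite ler_weXn2l.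
Qed.

Let atomV4_le n (c : R) : 0 <= c ->
  c / atom n.+1 ^+ 4 <= c * (4^-1) ^+ n.
Proof.
move=> c0; rewrite ler_wpM2l // exprVn lef_pV2 ?posrE ?exprn_gt0 //.
Qed.

(** By this ratio, [4 ^ n / 2] jumps of size at most [atom n] add up to at most a quarter of
    [atom n.+1]. *)
Let atomS n : atom n.+1 = 2 * 4 ^+ n * atom n :> R.
Proof.
rewrite /atom (_ : n.+1 * n.+1 = 1 + 2 * n + n * n)%N; last by lia.
have e : 2 ^+ (2 * n) = 4 ^+ n :> R by rewrite exprM; congr (_ ^+ n); ring.
by rewrite 2!exprD expr1 e.
Qed.

(** The tail bound is of order [2^-k] with [k] about [4 ^ n / 2], far smaller than required;
    [k < 2 ^ k] already brings it down to [4^-n]. *)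
Let many_jumps_le n :
  (P [set w | ((4 ^ n)./2 < N 1 w)%N] <= (4 * (4^-1) ^+ n)%:E)%E.
Proof.
apply: (le_trans (PP1_tail pp _)); rewrite lee_fin; set k := (4 ^ n)./2.
have k2 : (2 * k.+1 >= 4 ^ n)%N.
  by rewrite -[X in (X <= _)%N](odd_double_half (4 ^ n)) -/k -mul2n; case: odd; lia.
rewrite (_ : 4 * _ = 2 * (2 * (4^-1) ^+ n)); last by ring.
rewrite ler_pM2l // div1r !exprVn -[leLHS]div1r ler_pdivrMr ?exprn_gt0 //.
rewrite mulrAC ler_pdivlMr ?exprn_gt0 // mul1r -!natrX -natrM ler_nat.
by apply: leq_trans k2 _; rewrite leq_mul2l /= ltn_expl.
Qed.

(** The exceptional event collects a jump off the atoms, a dyadic time with [|B| > x], and more than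
    [4 ^ n / 2] jumps. Outside it, without a jump of size [atom n.+1], the Brownian and the jump
    part each stay below a quarter of [atom n.+1]. Both upper bounds below start from this event. *)
Lemma small_jump_exceedance : exists2 C : R, 0 <= C & forall n, exists E : set Ω,
  [/\ measurable E, (P E <= (C * (4^-1) ^+ n)%:E)%E & forall w, ~ E w ->
    (forall k, range atom (X k w)) /\
    (S (atom n.+1 / 2) w -> exists2 k, (k < N 1 w)%N & atom n.+1 <= X k w)].
Proof.
have c0 : 0 <= 320 * (40 * sigma) ^+ 4.
  exact: mulr_ge0 (ler0n _ _) (exprn_ge0 _ (mulr_ge0 (ler0n _ _) (ltW sigma0))).
exists (320 * (40 * sigma) ^+ 4 + 4); first exact: addr_ge0 c0 (ler0n _ _).
move=> n; set b := atom n.+1; have b0 : 0 < b := atom_gt0 n.+1.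
pose x := b / (4 * sigma).
have x0 : 0 < x by rewrite divr_gt0 // mulr_gt0.
have [E1 [mE1 PE1 E1P]] := BM_dyadic_maximal bm x0.
pose E2 := [set w | ((4 ^ n)./2 < N 1 w)%N].
have mE2 : measurable E2.
  exact: (@measurable_PP _ _ _ _ _ pp 1 [set m | ((4 ^ n)./2 < m)%N] ler01).
pose E3 := \bigcup_k X k @^-1` (~` range atom).
have mC : measurable (~` range (@atom R)).
  by apply: measurableC; exact: (@measurable_range_atom R).
have mE3 : measurable E3 by apply: bigcup_measurable => k _; exact: mXpre.
exists (E3 `|` (E1 `|` E2)); split.
- by apply: measurableU => //; exact: measurableU.
- rewrite mulrDl -[_ + _]add0r; apply: measureU_le => //; first exact: measurableU.
    (* The event [E3] is null: the geometric bound is applied with constant 0 and an arbitrary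
       ratio. *)
    rewrite -[X in (_ <= X%:E)%E](mul0r (1 - 2^-1)^-1).
    apply: (@measure_bigcup_geometric_le _ _ _ P _
      (fun k => X k @^-1` (~` range atom))) => //.
    + by apply/andP; split; lra.
    + by move=> k; exact: mXpre.
    + move=> k; rewrite mul0r; apply: (@le_trans _ _ 0%E) => //.
      by rewrite -jump_law_rangeC -(lawX k mC).
  apply: measureU_le => //; last exact: many_jumps_le.
  apply: (le_trans PE1); rewrite lee_fin.
  rewrite (_ : 320 / (x / 10) ^+ 4 = 320 * (40 * sigma) ^+ 4 / b ^+ 4).
    exact: atomV4_le.
  rewrite (_ : x / 10 = b / (40 * sigma)); last first.
    by rewrite /x; field; rewrite gt_eqF.
  by rewrite expr_div_n invf_div mulrA.
move=> w /not_orP[nE3 /not_orP[nE1 nE2]].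
have Xa k : range atom (X k w).
  by apply: contrapT => nX; apply: nE3; exists k.
split => // Sw.
have [+ _] := @lt_sup_process _ _ _ _ _ _ _ X sigma0 bm pp w (b / 2).
move=> /(_ Sw)[j [i [ij uY]]].
apply: contrapT => nX.
(* Jumps take values among the atoms, so one smaller than [atom n.+1] is at most [atom n]. *)
have Xle k : (k < N 1 w)%N -> X k w <= atom n.
  move=> kN; have [m _ Xm] := Xa k; rewrite -Xm.
  apply: atom_le; rewrite -ltnS; apply: (@atom_lt R); rewrite ltNge.
  by apply/negP => bX; apply: nX; exists k => //; rewrite -Xm.
have NtN1 : (N (dyadic j i) w <= N 1 w)%N.
  by apply: (PP_mono pp); [exact: dyadic_ge0|exact: dyadic_le1].
have Zle : compound_poisson N X (dyadic j i) w <= b / 4.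
  apply: (@le_trans _ _ ((N 1 w)%:R * atom n)).
    apply: (@le_trans _ _ ((N (dyadic j i) w)%:R * atom n)).
      rewrite -[X in X%:R](card_ord (N (dyadic j i) w)) mulr_natl -sumr_const.
      by apply: ler_sum => k _; apply: Xle; exact: leq_trans NtN1.
    by rewrite ler_wpM2r ?ler_nat // ltW // atom_gt0.
  have N2 : (2 * N 1 w <= 4 ^ n)%N.
    move/negP: nE2; rewrite -leqNgt => h.
    by rewrite mul2n -(odd_double_half (4 ^ n)) (leq_trans _ (leq_addl _ _)) ?leq_double.
  have {}N2 : 2 * (N 1 w)%:R <= 4 ^+ n :> R by rewrite -natrX -natrM ler_nat.
  rewrite /b atomS.
  have -> : 2 * 4 ^+ n * atom n / 4 = (4 ^+ n / 2) * atom n :> R by field.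
  rewrite ler_wpM2r ?(ltW (atom_gt0 _)) //; lra.
have := E1P w nE1 j i ij; rewrite ler_norml => /andP[_ Bx].
have : sigma * B (dyadic j i) w <= b / 4.
  rewrite (_ : b / 4 = sigma * x); last by rewrite /x; field; rewrite gt_eqF.
  by rewrite ler_pM2l.
move: uY; rewrite -/b; lra.
Qed.

(** Jumps are indexed from 0, so jump [k] has occurred by time 1 exactly when [k < N 1]. *)
Let big_jump (EB : set Ω) n (k : nat) :=
  EB `&` (N 1 @^-1` [set m | (k < m)%N] `&` X k @^-1` `[atom n, +oo[).

Let measurable_big_jump EB n k : sigma_proc `[0, +oo[ B EB ->
  measurable (big_jump EB n k).
Proof.
move=> hB; apply: measurableI; first exact: msigmaB.
by apply: measurableI; [apply: (measurable_PP pp)|apply: mXpre].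
Qed.

(** Independence bounds the [k]-th event by [c * (2 * 2^-k) * 2^-n], summable in [k]. The Brownian
    event is [setT] for the endpoint and a large [|B 1|] for the gap. *)
Lemma big_jump_bound (EB : set Ω) (c : R) n : sigma_proc `[0, +oo[ B EB ->
  (P EB <= c%:E)%E ->
  (P (\bigcup_k big_jump EB n k) <= (4 * c * (2^-1) ^+ n)%:E)%E.
Proof.
move=> hB Bc; have c0 : 0 <= c by rewrite -lee_fin (le_trans _ Bc).
have hN k : sigma_proc `[0, +oo[ N (N 1 @^-1` [set m | (k < m)%N]).
  by apply: sigma_proc_preimage => //; exact: nonneg.
have mE k := measurable_big_jump n k hB.
rewrite (_ : 4 * c * _ = (2 * c * (2^-1) ^+ n) / (1 - 1 / 2)); last by field.
apply: (@measure_bigcup_geometric_le _ _ _ P _ _ _ _ _ _ _ mE) => //.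
- by rewrite !mulr_ge0.
- by apply/andP; split; lra.
- exact: bigcup_measurable.
move=> k; apply: (@le_trans _ _ (P EB * (P (N 1 @^-1` [set m | (k < m)%N]) *
    jump_law `[atom n, +oo[))%E).
  by rewrite -(indep_BNX k hB (hN k) (measurable_itv _)).
rewrite (_ : 2 * c * _ * _ = c * ((2 * (1 / 2) ^+ k) * (2^-1) ^+ n)); last by ring.
rewrite 2!EFinM; apply: lee_pmul => //; first by rewrite mule_ge0.
by apply: lee_pmul => //; [exact: (PP1_tail pp)|exact: jump_law_tail].
Qed.

Let quarter_le_half n : (4^-1) ^+ n <= (2^-1) ^+ n :> R.
Proof. by rewrite lerXn2r ?nnegrE ?invr_ge0 //; lra. Qed.

(** An endpoint above [atom n.+1] makes the supremum exceed half of it, so outside a rare event some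
    jump is at least [atom n.+1], at a cost of order [2^-n]. *)
Lemma endpoint_upper_bound : exists2 C : R, 0 < C &
  forall n, (P (T (atom n.+1)) <= (C * (2^-1) ^+ n)%:E)%E.
Proof.
have [C C0 hC] := small_jump_exceedance.
exists (C + 2) => [|n]; first by rewrite ltr_wpDl.
have [E [mE PE EP]] := hC n.
have hT : sigma_proc `[0, +oo[ B setT by exact: sigma_procT.
apply: (@le_trans _ _ (P (E `|` \bigcup_k big_jump setT n.+1 k))).
  apply: le_measure; rewrite ?inE //.
    apply: measurableU => //; apply: bigcup_measurable => k _.
    exact: measurable_big_jump.
  move=> w Tw; have [Ew|nE] := pselect (E w); [by left|right].
  have [_ []] := EP w nE.
    apply: TS; apply: lt_trans Tw.
    by have := atom_gt0 (R := R) n.+1; lra.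
  by move=> k kN Xk; exists k => //; split => //; split; rewrite //= in_itv /= Xk.
rewrite mulrDl; apply: measureU_le => //.
- by apply: bigcup_measurable => k _; exact: measurable_big_jump.
- apply: (le_trans PE); rewrite lee_fin ler_wpM2l //.
rewrite (_ : 2 * _ = 4 * 1 * (2^-1) ^+ n.+1); last by rewrite exprS; field.
by apply: big_jump_bound => //; rewrite probability_setT.
Qed.

(** Outside the rare event a jump of size at least [b] has occurred, so an endpoint at most [b / 2]
    requires [|B 1| > b / (4 * sigma)], which alone has probability [O(4^-n)]. *)
Lemma gap_upper_bound : exists2 C : R, 0 <= C & forall n,
  (P (S (atom n.+1 / 2)%R `\` T (atom n.+1 / 2)%R) <= (C * (4^-1) ^+ n)%:E)%E.
Proof.
have [C C0 hC] := small_jump_exceedance.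
(* With [x = b / (4 * sigma)], the tail bound [2 * (2 / (x ^+ 2 / 4) ^+ 2)] equals [D / b ^+ 4]. *)
pose D := 64 * (4 * sigma) ^+ 4.
have D0 : 0 <= D.
  exact: mulr_ge0 (ler0n _ _) (exprn_ge0 _ (mulr_ge0 (ler0n _ _) (ltW sigma0))).
exists (C + 4 * D) => [|n].
  exact: addr_ge0 C0 (mulr_ge0 (ler0n _ _) D0).
have [E [mE PE EP]] := hC n; set b := atom n.+1 in EP *.
have b0 : 0 < b := atom_gt0 n.+1.
pose x := b / (4 * sigma).
have x0 : 0 < x by rewrite divr_gt0 // mulr_gt0.
pose EB := B 1 @^-1` [set y | x < `|y|].
have hB : sigma_proc `[0, +oo[ B EB.
  by apply: sigma_proc_preimage; [exact: nonneg|exact: measurable_gt_norm].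
have PB : (P EB <= (D * (4^-1) ^+ n)%:E)%E.
  have -> : EB = [set w | x < `|B 1 w - B 0 w|].
    by apply/seteqP; split => w; rewrite /EB /= (BM0 bm) subr0.
  apply: (le_trans (BM_increment_tail bm (lexx 0) ltr01 (ltW x0))).
  rewrite lee_fin subr0 mulr1.
  apply: (@le_trans _ _ (D / b ^+ 4)); last exact: atomV4_le.
  apply: (@le_trans _ _ (2 * (2 / (x ^+ 2 / 4) ^+ 2))).
    by rewrite ler_pM2l // expRN_le_sqr // divr_gt0 // exprn_gt0.
  rewrite le_eqVlt; apply/orP; left; apply/eqP; rewrite /x /D; field.
  by rewrite !gt_eqF.
apply: (@le_trans _ _ (P (E `|` \bigcup_k big_jump EB n.+1 k))).
  apply: le_measure; rewrite ?inE //.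
  - exact: measurableD.
  - apply: measurableU => //; apply: bigcup_measurable => k _.
    exact: measurable_big_jump.
  move=> w [Sw nT]; have [Ew|nE] := pselect (E w); [by left|right].
  have [Xa /(_ Sw)[k kN bX]] := EP w nE.
  exists k => //; split; last by split; rewrite //= in_itv /= bX.
  rewrite /EB /= ltNge; apply/negP => Bx; apply: nT.
  rewrite /T /= /Y.
  (* All jumps are positive atoms, so the large one bounds the whole sum from below. *)
  have Zge : b <= compound_poisson N X 1 w.
    rewrite /compound_poisson (bigD1 (Ordinal kN)) //=.
    apply: (le_trans bX); rewrite lerDl sumr_ge0 // => i _.
    by have [m _ <-] := Xa i; exact/ltW/atom_gt0.
  have : - (b / 4) <= sigma * B 1 w.
    rewrite (_ : b / 4 = sigma * x); last by rewrite /x; field; rewrite gt_eqF.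
    by rewrite -mulrN ler_pM2l //; move: Bx; rewrite ler_norml => /andP[].
  lra.
rewrite mulrDl; apply: measureU_le => //.
  by apply: bigcup_measurable => k _; exact: measurable_big_jump.
apply: (le_trans (big_jump_bound _ hB PB)); rewrite lee_fin (mulrA 4 D).
(* The surplus factor [2^-(n+1)], the cost of the large jump, is dropped. *)
apply: ler_piMr; last by rewrite exprn_ile1 //; lra.
apply: mulr_ge0; last exact: exprn_ge0.
exact: mulr_ge0 (ler0n _ _) D0.
Qed.

(** * Limits of the ratio *)

Let Pfine (A : set Ω) : measurable A -> P A = (fine (P A))%:E.
Proof. by move=> mA; rewrite fineK // fin_num_measure. Qed.

(** Every level lies below some atom. Positivity keeps [sup_ratio] away from the convention that
    division by 0 gives 0. *)
Let endpoint_gt0 u : 0 < fine (P (T u)).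
Proof.
have [c c0 hc] := endpoint_lower_bound.
have [n un] : exists n, u < atom n.
  exists (Num.truncn `|u|).+1; apply: lt_le_trans (expn_le_atom _).
  have := truncnS_gt `|u|; move: (Num.truncn _) => m um.
  apply: le_lt_trans (ler_norm u) _; apply: lt_trans um _.
  by rewrite -natrX ltr_nat ltn_expl.
have := hc n u un; rewrite (Pfine (mT u)) lee_fin; apply: lt_le_trans.
by rewrite mulr_gt0.
Qed.

(** [T u] is contained in [S u], so both limits reduce to comparing the gap with the endpoint
    probability. *)
Let ratioE u : sup_ratio P Y u =
  1 + fine (P (S u `\` T u)) / fine (P (T u)).
Proof.
rewrite /sup_ratio -/(S u) -/(T u).
have -> : P (S u) = (P (T u) + P (S u `\` T u))%E.
  by rewrite -measureU //; [rewrite setDUK|exact: measurableD|rewrite setDIK].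
rewrite fineD ?fin_num_measure //; last exact: measurableD.
by rewrite mulrDl divff // gt_eqF.
Qed.

Lemma limsup_liminf_sup_ratio : (1%:E < limsup_pinfty (sup_ratio P Y))%E /\
  liminf_pinfty (sup_ratio P Y) = 1%:E.
Proof.
have atom_unbounded M : exists m, forall n, (m <= n)%N -> M < atom n / 2 :> R.
  exists (Num.truncn `|M|).+2 => n mn; rewrite ltr_pdivlMr //.
  apply: lt_le_trans (le_trans (expn_le_atom _) (atom_le mn)).
  have := truncnS_gt `|M|; move: (Num.truncn _) => m um.
  rewrite exprSr ltr_pM2r //; apply: le_lt_trans (ler_norm M) _.
  by apply: lt_trans um _; rewrite -natrX ltr_nat ltn_expl.
split.
  have [c c0 hc] := gap_lower_bound.
  have [C C0 hC] := endpoint_upper_bound.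
  (* At level [atom m.+1] the gap is at least [c * 2^-(m+1)] and the endpoint probability at most
     [C * 2^-m]. *)
  apply: (@lt_le_trans _ _ (1 + c / (2 * C))%:E).
    by rewrite lte_fin ltrDl divr_gt0 // mulr_gt0.
  apply: limsup_pinfty_ge => M; have [m hm] := atom_unbounded M.
  exists (atom m.+1).
    have := hm m.+1 (leqnSn m); have := atom_gt0 (R := R) m.+1; lra.
  rewrite ratioE lerD2l ler_pdivlMr ?endpoint_gt0 //.
  have := hc m.+1; rewrite Pfine ?lee_fin; last exact: measurableD.
  apply: le_trans; have := hC m; rewrite Pfine // lee_fin => TC.
  rewrite mulrAC ler_pdivrMr ?mulr_gt0 // -mulrA ler_pM2l //.
  by apply: (le_trans TC); rewrite exprS; lra.
apply/eqP; rewrite eq_le; apply/andP; split; last first.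
  apply: liminf_pinfty_ge => u; rewrite ratioE lerDl divr_ge0 // ?fine_ge0 //.
apply: liminf_pinfty_le => M e e0.
have [c c0 hc] := endpoint_lower_bound.
have [C C0 hC] := gap_upper_bound.
have [m hm] := atom_unbounded M.
(* At level [atom n.+1 / 2] the gap is at most [C * 4^-n] and the endpoint probability at least
   [c * 2^-(n+1)], whence the quotient [2 * C / c * 2^-n]. *)
have [m' hm'] : exists m', forall n, (m' <= n)%N -> 2 * C / c * (2^-1) ^+ n < e.
  have h1 : `|(2^-1 : R)| < 1 by rewrite ger0_norm; lra.
  have [m' _ h] := cvgr_lt _ (cvg_geometric (2 * C / c) h1) _ e0.
  by exists m'.
pose n := maxn m m'; exists (atom n.+1 / 2).
  by apply: hm; rewrite leqW // leq_maxl.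
rewrite ratioE lerD2l; apply: le_trans (ltW (hm' n (leq_maxr _ _))).
rewrite ler_pdivrMr ?endpoint_gt0 //.
have := hC n; rewrite Pfine ?lee_fin; last exact: measurableD.
move=> /le_trans; apply.
have : atom n.+1 / 2 < atom n.+1 :> R by have := atom_gt0 (R := R) n.+1; lra.
move=> /hc; rewrite Pfine // lee_fin => cT.
apply: (@le_trans _ _ (2 * C / c * 2^-1 ^+ n * (c * 2^-1 ^+ n.+1))).
  rewrite le_eqVlt; apply/orP; left; apply/eqP.
  have -> : (4^-1 : R) = 2^-1 * 2^-1 by field.
  by rewrite exprMn exprS; field; rewrite gt_eqF.
by rewrite ler_wpM2l // mulr_ge0 ?exprn_ge0 // divr_ge0 ?mulr_ge0 // ltW.
Qed.

End ratio.

Unset Implicit Arguments.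

(* There is a compound Poisson process with positive jumps (i.e. a rate
   lam > 0 and a jump law F concentrated on (0, +oo)) such that for every
   sigma > 0 and every realization X = sigma B + Z with B a standard BM
   independent of Z (Z built from a rate-lam Poisson process N and iid
   F-distributed jumps Xj, with B, N, Xj_0, Xj_1, ... mutually independent),
   limsup ratio > 1 and liminf ratio = 1. *)
Theorem theorem4 (R : realType) :
  exists (lam : R) (F : probability R R),
    0 < lam /\ F [set x : R | x <= 0] = 0%E /\
    forall (sigma : R), 0 < sigma ->
    forall (d : measure_display) (Ω : measurableType d) (P : probability Ω R)
      (B : R -> Ω -> R) (N : R -> Ω -> nat) (Xj : nat -> Ω -> R),
      standard_BM P B ->
      poisson_process P lam N ->
      (forall k, measurable_fun setT (Xj k)) ->
      (forall k (A : set R), measurable A -> P (Xj k @^-1` A) = F A) ->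
      mutually_independent P (fun i : cpp_idx =>
        match i with
        | idxB => sigma_proc `[0, +oo[ B
        | idxN => sigma_proc `[0, +oo[ N
        | idxX k => sigma_rv (Xj k)
        end) ->
      let X := fun t w => sigma * B t w + compound_poisson N Xj t w in
      (1%:E < limsup_pinfty (sup_ratio P X))%E /\
      liminf_pinfty (sup_ratio P X) = 1%:E.
Proof.
exists 1, (@jump_law R); split => //; split.
  apply/eqP; rewrite eq_le measure_ge0 andbT.
  (* Every atom is positive, so the nonpositive half-line lies in the null complement of the
     atoms. *)
  rewrite -[leRHS](@jump_law_rangeC R); apply: le_measure; rewrite ?inE.
  - rewrite (_ : mkset _ = `]-oo, 0]%classic); first exact: measurable_itv.
    by apply/seteqP; split => x /=; rewrite in_itv.
  - by apply: measurableC; exact: (@measurable_range_atom R).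
  by move=> x /= x0 [n _ an]; move: x0; rewrite -an leNgt atom_gt0.
move=> sigma sigma0 d Ω P B N Xj bm pp mX lawX indep X.
exact: limsup_liminf_sup_ratio.
Qed.
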